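(* For every $\varepsilon > 0$ there exists a constant $C = C(\varepsilon) > 0$ such that for all integers $n \ge 2$ and all integers $x$, $$\left| \mathbb{P}(D_n = x) - \frac{1}{\sqrt{2\pi}\,\sigma_n} e^{-\left(\frac{x-\mu_n}{\sigma_n}\right)^2/2} \right| \le C\, n^{-1+\varepsilon}.$$ (Since $\sigma_n = \Theta(n^{1/2})$, this error is $O\left(\frac{1}{\sigma_n} n^{-1/2+\varepsilon}\right)$.)
   Context: For $n\ge 2$ let $\pi$ be a uniformly random permutation of $\{1,\dots,n\}$. The number of descents is $D_n = |\{1 \le j < n : \pi(j) > \pi(j+1)\}|$. Write $\mu_n = \mathbb{E}[D_n] = \frac{n-1}{2}$ and let $\sigma_n > 0$ be the standard deviation of $D_n$, so $\sigma_n^2 = \mathrm{Var}(D_n) = \frac{n+1}{12}$. *)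

(* Defs.v *)
From mathcomp Require Import all_boot all_order all_algebra all_fingroup.
From mathcomp Require Import all_classical all_reals all_analysis.

Set Implicit Arguments.
Unset Strict Implicit.
Unset Printing Implicit Defensive.

Import Order.TTheory GRing.Theory Num.Theory.

Local Open Scope ring_scope.

(* Positions and values are 0-based: 'I_n stands for {1, ..., n}, and a
   position j is a descent only if it has a successor k in 'I_n. *)
Definition descents (n : nat) (s : 'S_n) : nat :=
  #|[set j : 'I_n | [exists k : 'I_n, (k == j.+1 :> nat) && (s k < s j)%N]]|.

Section UniformPermutation.
Variables (R : realType) (n : nat).

Definition perm_prob (A : {set 'S_n}) : R := #|A|%:R / #|[set: 'S_n]|%:R.

Definition perm_mean (X : 'S_n -> R) : R :=
  (\sum_(s : 'S_n) X s) / #|[set: 'S_n]|%:R.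

Definition perm_var (X : 'S_n -> R) : R :=
  perm_mean (fun s => (X s - perm_mean X) ^+ 2).

End UniformPermutation.

Definition des_mean (R : realType) (n : nat) : R :=
  perm_mean (fun s : 'S_n => (descents s)%:R).

Definition des_sd (R : realType) (n : nat) : R :=
  Num.sqrt (perm_var (fun s : 'S_n => (descents s)%:R)).

(* Main.v *)
Require Import Defs.
From mathcomp Require Import all_boot all_order all_algebra all_fingroup.
From mathcomp Require Import all_classical all_reals all_analysis.
From mathcomp Require Import zify ring lra.

Set Implicit Arguments.
Unset Strict Implicit.
Unset Printing Implicit Defensive.

Import Order.TTheory GRing.Theory Num.Theory.
Import numFieldNormedType.Exports.

Local Open Scope ring_scope.

(* The number of permutations with k descents is an Eulerian number A(n, k), and
   inserting the largest letter gives
     A(n+1, k+1) = (k+2) A(n, k+1) + (n-k) A(n, k).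
   The induced map on consecutive ratios A(n, k+1) / A(n, k) is monotone in each
   ratio, so an explicit function which is a super-solution (resp. sub-solution)
   of it bounds all the ratios by induction on n. Past the middle this yields
     1 - (6 d + 24) / n <= A(n, k+1) / A(n, k) <= ((n-k) / (k+2))^3
   with d = 2 k + 2 - n, and both sides are exp (- 6 d / n) up to
   O(d^2 / n^2 + 1 / n). Multiplying the ratios from the centre outwards, with
   w = k - (n-1)/2,
     A(n, k) / n! = q exp (- 6 w^2 / (n+1)) (1 + O(|w|^3 / n^2 + |w| / n)).
   The constant q is then found from the total mass 1, comparing the sum of
   the Gaussian weights with the Gaussian integral; the final error is
   O(1/n). *)

(** * Descents after inserting the largest letter *)

Definition wdes (n : nat) (w : nat -> nat) : nat :=
  (\sum_(0 <= j < n.-1) (w j.+1 < w j))%N.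

Definition insert_at (i : nat) (v : nat) (w : nat -> nat) (j : nat) : nat :=
  if (j < i)%N then w j else if j == i then v else w j.-1.

(** The default [0] beyond [n] is harmless: [wdes n] reads only indices below [n]. *)
Definition word (n : nat) (s : 'S_n) (j : nat) : nat :=
  oapp (fun i : 'I_n => nat_of_ord (s i)) 0%N (insub j).

Lemma word_ord (n : nat) (s : 'S_n) (i : 'I_n) : word s i = s i.
Proof. by rewrite /word valK. Qed.

Lemma word_lt (n : nat) (s : 'S_n) j : (j < n)%N -> (word s j < n)%N.
Proof. by move=> jn; rewrite -[j]/(nat_of_ord (Ordinal jn)) word_ord. Qed.

Lemma descents_wdes (n : nat) (s : 'S_n) : descents s = wdes n (word s).
Proof.
rewrite /descents /wdes -sum1_card big_mkcond /=.
case: n s => [|n] s; first by rewrite big_ord0 big_geq.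
rewrite [RHS]big_mkord big_ord_recr /=.
(* The last position has no successor, hence the [n.-1] terms of [wdes]. *)
have -> : (ord_max \in [set j : 'I_n.+1 |
    [exists k : 'I_n.+1, (k == j.+1 :> nat) && (s k < s j)%N]]) = false.
  apply/negbTE; rewrite inE; apply/existsP => -[k /andP[/eqP /= kj _]].
  by have := ltn_ord k; rewrite kj ltnn.
rewrite addn0; apply: eq_bigr => j _; rewrite inE.
have jn : (j.+1 < n.+1)%N := ltn_ord j.
rewrite -[j.+1 in RHS]/(nat_of_ord (Ordinal jn)) word_ord.
rewrite -[X in word s X]/(nat_of_ord (widen_ord (leqnSn n) j)) word_ord.
case: existsP => [[k /andP[/eqP kj ks]]|H].
  by rewrite (_ : Ordinal jn = k) ?ks //; apply: val_inj.
case: ltnP => // H1; case: H; exists (Ordinal jn).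
by rewrite eqxx.
Qed.

(* A maximal letter [n] creates a descent unless it is appended at the end or
   splits an existing descent. *)
Lemma wdes_insert (n i : nat) (w : nat -> nat) :
  (0 < n)%N -> (forall j, (j < n)%N -> (w j < n)%N) -> (i <= n)%N ->
  wdes n.+1 (insert_at i n w) =
  if (i == n) || ((0 < i)%N && (w i < w i.-1)%N) then wdes n w
  else (wdes n w).+1.
Proof.
case: n => // n _ wn; rewrite /wdes /=; case: i => [|i] lein.
  by rewrite big_nat_recl // {1 2}/insert_at /= wn.
(* Split at the inserted letter: pairs before it are unchanged, pairs after it are shifted by one,
   and only the pairs meeting it need a case analysis. *)
have cut m F : (i <= m)%N ->
    (\sum_(0 <= j < m) F j = \sum_(0 <= j < i) F j + \sum_(i <= j < m) F j)%N.
  by move=> im; rewrite (big_cat_nat (n := i)).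
rewrite (cut n.+1) ?(ltnW lein) // !(cut n) //.
rewrite [X in (_ + X)%N = _]big_ltn //.
have -> : (\sum_(0 <= j < i)
    (insert_at i.+1 n.+1 w j.+1 < insert_at i.+1 n.+1 w j) =
    \sum_(0 <= j < i) (w j.+1 < w j))%N.
  by apply: eq_big_nat => j /andP[_ ji]; rewrite /insert_at !ltnS ji (ltnW ji).
rewrite {1 2}/insert_at ltnn eqxx ltnS leqnn ltnNge ltnW ?wn //= add0n eqSS.
have [lein'|ni|->] := ltngtP i n; [|by lia|by rewrite !(big_geq (leqnn _))].
rewrite [X in (_ + X)%N = _]big_ltn //.
rewrite {1 2}/insert_at ltnn eqxx [(i.+2 < _)%N]ltnNge leqnSn /=.
rewrite (gtn_eqF (ltnSn _)) wn // (big_ltn lein').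
rewrite big_add1 /=.
have -> : (\sum_(i.+1 <= j < n)
    (insert_at i.+1 n.+1 w j.+2 < insert_at i.+1 n.+1 w j.+1) =
    \sum_(i.+1 <= j < n) (w j.+1 < w j))%N.
  apply: eq_big_nat => j /andP[ij jn]; rewrite /insert_at.
  by rewrite !ifF //; lia.
by case: ltnP => _; lia.
Qed.

(** Counts the slots that leave the number of descents unchanged: the end, and one inside each
    descent. *)
Lemma sum_keep (n : nat) (w : nat -> nat) : (0 < n)%N ->
  (\sum_(0 <= i < n.+1) ((i == n) || ((0 < i) && (w i < w i.-1))))%N =
  (wdes n w).+1.
Proof.
case: n => // n _; rewrite big_nat_recr //= eqxx /= addn1 big_nat_recl //=.
congr _.+1; rewrite /wdes /= add0n; apply: eq_big_nat => i /andP[_ hi].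
by rewrite eqSS (ltn_eqF hi).
Qed.

Lemma lift_perm_word (n : nat) (i : 'I_n.+1) (s : 'S_n) (j : nat) :
  (j <= n)%N ->
  word (lift_perm i ord_max s) j = insert_at i n (word s) j.
Proof.
move=> jn; have jn' : (j < n.+1)%N by [].
rewrite -[j]/(nat_of_ord (Ordinal jn')) word_ord /insert_at.
case: (unliftP i (Ordinal jn')) => [k|] ->; last first.
  by rewrite lift_perm_id ltnn eqxx.
rewrite lift_perm_lift /= /bump [(n <= s k)%N]leqNgt ltn_ord /= add0n.
case: (leqP i k) => ik; rewrite ?add0n ?add1n ?ik ?word_ord //.
by rewrite ltnNge leqW //= (gtn_eqF (_ : i < k.+1)%N) // word_ord.
Qed.

(** The position of [j] recovers [i], and then [s]; injectivity suffices because both index sets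
    have (n + 1)! elements. *)
Lemma sum_perm_succ (V : nmodType) (n : nat) (F : 'S_n.+1 -> V) (j : 'I_n.+1) :
  \sum_(s : 'S_n.+1) F s =
  \sum_(s : 'S_n) \sum_(i : 'I_n.+1) F (lift_perm i j s).
Proof.
rewrite pair_big /=.
apply: (reindex (fun p : 'S_n * 'I_n.+1 => lift_perm p.2 j p.1)).
apply: onW_bij; apply: inj_card_bij; last first.
  by rewrite card_prod card_ord !card_Sn factS mulnC.
move=> [s i] [t k] /= e.
have ik : i = k.
  apply: (@perm_inj _ (lift_perm i j s)).
  by rewrite lift_perm_id e lift_perm_id.
move: e; rewrite {}ik => /permP e; congr (_, _); apply/permP => l.
by apply: (@lift_inj _ j); rewrite -!(lift_perm_lift k) e.
Qed.

Lemma descents_lift_perm (n : nat) (i : 'I_n.+1) (s : 'S_n) : (0 < n)%N ->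
  descents (lift_perm i ord_max s) =
  if (i == n :> nat) || ((0 < i)%N && (word s i < word s i.-1)%N)
  then descents s else (descents s).+1.
Proof.
move=> n0; rewrite !descents_wdes -wdes_insert //; last 2 first.
- exact: word_lt.
- by rewrite -ltnS.
apply: eq_big_nat => j /andP[_ jn].
by rewrite !lift_perm_word // ltnW.
Qed.

(** The function [f] stays general: indicators give the Eulerian recurrence, first and second powers
    give the moments. *)
Lemma sum_perm_descents (V : nmodType) (n : nat) (f : nat -> V) : (0 < n)%N ->
  \sum_(s : 'S_n.+1) f (descents s) =
  \sum_(s : 'S_n) (f (descents s) *+ (descents s).+1
                   + f (descents s).+1 *+ (n - descents s)).
Proof.
move=> n0; rewrite (sum_perm_succ _ ord_max); apply: eq_bigr => s _.
under eq_bigr do rewrite descents_lift_perm //.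
pose keep (i : 'I_n.+1) :=
  (i == n :> nat) || ((0 < i)%N && (word s i < word s i.-1)%N).
have card_keep : #|keep| = (descents s).+1.
  rewrite -sum1_card descents_wdes -sum_keep // big_mkord big_mkcond /=.
  by apply: eq_bigr => i _; rewrite unfold_in /keep; case: ifP.
rewrite (bigID keep) /= -card_keep; congr (_ + _).
  rewrite -sumr_const; apply: eq_big => // i.
  by rewrite /keep => ->.
have -> : (n - descents s)%N = #|[predC keep]|.
  have := cardC keep; rewrite card_ord card_keep => E.
  by rewrite -(addKn (descents s).+1 #|[predC keep]|) E subSS.
rewrite -sumr_const; apply: eq_big => // i.
by rewrite /keep => /negbTE ->.
Qed.

(** * Eulerian numbers and their consecutive ratios *)

Definition eulerian (n k : nat) : nat := #|[set s : 'S_n | descents s == k]|.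

Lemma eulerian_sum (n k : nat) :
  eulerian n k = (\sum_(s : 'S_n) (descents s == k))%N.
Proof.
rewrite /eulerian -sum1_card big_mkcond /=.
by apply: eq_bigr => s _; rewrite inE; case: eqP.
Qed.

Lemma eulerian1 k : eulerian 1 k = (k == 0%N).
Proof.
have D0 (s : 'S_1) : descents s = 0%N by rewrite descents_wdes /wdes big_geq.
rewrite eulerian_sum; under eq_bigr do rewrite D0 eq_sym.
by rewrite sum_nat_const card_Sn mul1n.
Qed.

Lemma eulerianS0 n : (0 < n)%N -> eulerian n.+1 0 = eulerian n 0.
Proof.
move=> n0; rewrite !eulerian_sum.
rewrite (sum_perm_descents (fun d => (d == 0 : nat)) n0).
by apply: eq_bigr => s _; case: (descents s) => [|d] /=; lia.
Qed.

Lemma eulerianSS n k : (0 < n)%N ->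
  eulerian n.+1 k.+1 = (k.+2 * eulerian n k.+1 + (n - k) * eulerian n k)%N.
Proof.
move=> n0; rewrite !eulerian_sum.
rewrite (sum_perm_descents (fun d => (d == k.+1 : nat)) n0).
rewrite !big_distrr -big_split /=; apply: eq_bigr => s _.
rewrite eqSS; congr addn; case: eqP => [->|_] /=; rewrite ?muln0 ?mul0rn //.
  by rewrite muln1; lia.
by rewrite muln1; lia.
Qed.

Lemma eulerian_eq0 n k : (0 < n)%N -> (n <= k)%N -> eulerian n k = 0%N.
Proof.
case: n => // n _; elim: n k => [|n IHn] [|k] // nk; first by rewrite eulerian1.
by rewrite eulerianSS // !IHn ?muln0 // ltnW.
Qed.

(** The substitution k -> n - k exchanges the two terms of the recurrence; at the two extreme
    indices one term vanishes by [eulerian_eq0]. *)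
Lemma eulerian_sym n k : (k <= n)%N -> eulerian n.+1 (n - k) = eulerian n.+1 k.
Proof.
elim: n k => [|n IHn] k kn; first by case: k kn.
case: k kn => [_|k kn].
  rewrite subn0 eulerianSS // eulerianS0 // (eulerian_eq0 (k := n.+1)) //.
  by have := IHn 0%N isT; rewrite subn0 subSn // subnn => ->; lia.
rewrite subSS; have [kn'|nk|->] := ltngtP k n; [|by lia|].
  have IH1 := IHn k.+1 kn'; have IH2 := IHn k (ltnW kn').
  have nkE : (n - k = (n - k.+1).+1)%N by lia.
  rewrite nkE !(@eulerianSS n.+1) // -nkE IH1 IH2 addnC.
  by congr (_ * _ + _ * _)%N; lia.
rewrite subnn eulerianS0 // eulerianSS // (eulerian_eq0 (k := n.+1)) //.
by have := IHn n (leqnn n); rewrite subSn // subnn => ->; lia.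
Qed.

Lemma descents_lt n (s : 'S_n) : (0 < n)%N -> (descents s < n)%N.
Proof.
move=> n0; rewrite descents_wdes /wdes -[n in (_ < n)%N]prednK // ltnS.
rewrite -[X in (_ <= X)%N]muln1 -[X in (_ <= X * _)%N]subn0 -sum_nat_const_nat.
by apply: leq_sum => i _; case: ltnP.
Qed.

Lemma sum_eulerian (n : nat) : (0 < n)%N ->
  (\sum_(0 <= k < n) eulerian n k = n`!)%N.
Proof.
move=> n0; under eq_bigr do rewrite eulerian_sum.
rewrite exchange_big /= -card_Sn -sum1_card.
apply: eq_bigr => s _.
rewrite big_mkord (bigD1 (Ordinal (descents_lt s n0))) //= eqxx.
rewrite big1 ?addn0 // => i.
by rewrite -val_eqE /= eq_sym => /negbTE ->.
Qed.

Section Ratios.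
Variable R : realFieldType.
Implicit Types n k : nat.

Lemma eulerian_succ_real n k : (0 < n)%N ->
  (eulerian n.+1 k.+1)%:R =
    (k%:R + 2) * (eulerian n k.+1)%:R + (n%:R - k%:R) * (eulerian n k)%:R :> R.
Proof.
move=> n0; rewrite eulerianSS // natrD !natrM.
(* Truncated and real subtraction differ only for k > n, where A(n, k) = 0. *)
case: (leqP k n) => kn; first by rewrite natrB // -[k.+2]addn2 natrD.
rewrite (eulerian_eq0 (k := k)) // ?mulr0; last exact: ltnW.
by rewrite -[k.+2]addn2 natrD.
Qed.

Lemma eulerian_middle n k : n = k.*2 -> eulerian n.+2 k.+1 = eulerian n.+2 k.
Proof.
move=> nk; rewrite -(eulerian_sym (k := k)); last by lia.
by congr eulerian; lia.
Qed.

(** Here [a], [b], [c] are consecutive Eulerian numbers, by decreasing index. Eliminating [a] and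
    [c] through the hypotheses leaves [b] times (x - y)^3 + (x - y), which is nonnegative past the
    middle. *)
Lemma ratio_step_le (a b c x y : R) : 0 <= b -> 0 <= y -> y <= x ->
  a * (x + 1) ^+ 3 <= b * y ^+ 3 -> b * x ^+ 3 <= c * (y + 1) ^+ 3 ->
  ((x + 1) * a + y * b) * (x + 1) ^+ 3 <= (x * b + (y + 1) * c) * (y + 1) ^+ 3.
Proof.
move=> b0 y0 yx h1 h2.
have x0 : 0 <= x by apply: le_trans yx.
have k1 : (x + 1) * (a * (x + 1) ^+ 3) <= (x + 1) * (b * y ^+ 3).
  by apply: ler_wpM2l => //; lra.
have k2 : (y + 1) * (b * x ^+ 3) <= (y + 1) * (c * (y + 1) ^+ 3).
  by apply: ler_wpM2l => //; lra.
have k3 : 0 <= b * ((x - y) * ((x - y) ^+ 2 + 1)).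
  by rewrite !mulr_ge0 ?subr_ge0 // addr_ge0 ?sqr_ge0.
by move: k1 k2 k3; rewrite !exprS !expr0; lra.
Qed.

(** With d = x - y, the two earlier ratios sit at d + 1 and d - 1, hence the shifts of [t] by 6. *)
Lemma ratio_step_ge (a b c x y n t : R) :
  n = x + y - 1 -> t = 6 * (x - y) + 24 ->
  0 <= a -> 0 <= b -> 0 <= c -> 0 <= y -> 1 <= x - y -> 0 < n ->
  b * (n - (t + 6)) <= a * n -> c * (n - (t - 6)) <= b * n ->
  (x * b + (y + 1) * c) * (n + 1 - t) <= ((x + 1) * a + y * b) * (n + 1).
Proof.
move=> nE tE a0 b0 c0 y0 xy n0 h1 h2.
have x0 : 0 <= x by lra.
(* If the factor on the left is not positive the claim is a comparison of signs; otherwise [B] is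
   positive and denominators can be cleared. *)
have [st|st] := lerP (n + 1) t.
  apply: (@le_trans _ _ 0).
    by apply: mulr_ge0_le0; [apply: addr_ge0; apply: mulr_ge0; lra | lra].
  by apply: mulr_ge0; [apply: addr_ge0; apply: mulr_ge0; lra | lra].
set B := n - (t - 6) in h2.
have B0 : 0 < B by rewrite /B; lra.
rewrite -(ler_pM2r (mulr_gt0 n0 B0)).
have k1 : (x + 1) * (n + 1) * B * (b * (n - (t + 6))) <=
    (x + 1) * (n + 1) * B * (a * n).
  by apply: ler_wpM2l => //; rewrite !mulr_ge0 //; lra.
have k2 : (y + 1) * (n + 1 - t) * n * (c * B) <=
    (y + 1) * (n + 1 - t) * n * (b * n).
  by apply: ler_wpM2l => //; rewrite !mulr_ge0 //; lra.
have k3 : 0 <= b * (((x + 1) * (n - (t + 6)) + y * n) * (n + 1) * B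
      - (x * B + (y + 1) * n) * n * (n + 1 - t)).
  apply: mulr_ge0 => //.
  (* In these variables the polynomial left after eliminating [a] and [c] has only positive
     coefficients. *)
  pose s := x + y; pose d := x - y.
  have s0 : 0 <= s by rewrite /s; lra.
  have d0 : 0 <= d by rewrite /d; lra.
  have -> : ((x + 1) * (n - (t + 6)) + y * n) * (n + 1) * B
      - (x * B + (y + 1) * n) * n * (n + 1 - t) =
      6 * s ^+ 2 + 72 * d ^+ 2 * s + 480 * d * s + 780 * s + 18 * d ^+ 3
      + 126 * d ^+ 2 + 222 * d + 24 by rewrite /s /d /B nE tE; field.
  have ds : 0 <= d * s by exact: mulr_ge0.
  have dds : 0 <= d ^+ 2 * s by rewrite mulr_ge0 ?exprn_ge0.
  have := exprn_ge0 3 d0; have := exprn_ge0 2 d0; have := exprn_ge0 2 s0.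
  by rewrite -!mulrA; lra.
by rewrite /B in k1 k2 k3 *; lra.
Qed.

(* [(n - k) / (k + 2)] is the ratio of the binomials 'C(n + 1, k + 2) and
   'C(n + 1, k + 1): past the middle, Eulerian numbers decay at least as fast
   as cubes of binomials. *)
Lemma eulerian_ratio_le n k : (0 < n)%N -> (n <= k.*2.+2)%N ->
  (eulerian n k.+1)%:R * (k%:R + 2) ^+ 3 <=
  (eulerian n k)%:R * (n%:R - k%:R) ^+ 3 :> R.
Proof.
case: n => // n _; elim: n k => [|n IHn] k nk.
  rewrite (eulerian_eq0 (k := k.+1)) // mul0r eulerian1.
  by case: k nk => [|k] _ //=; rewrite ?mul1r ?mul0r // subr0 expr1n.
(* At n = 2 k the recurrence would call on a ratio before the middle, where the induction hypothesis
   says nothing; symmetry gives the ratio 1 instead. *)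
have [nk2|nk2] := eqVneq n k.*2.
  have -> : n.+2%:R - k%:R = k%:R + 2 :> R.
    by rewrite nk2 -addn2 -addnn !natrD; lra.
  by rewrite eulerian_middle.
have [kn|kn] := leqP n.+2 k.
  by rewrite !eulerian_eq0 ?mul0r // ltnW.
case: k => [|k] in nk nk2 kn *; first by lia.
rewrite !(@eulerian_succ_real n.+1) // -!(@natr1 R n.+1).
rewrite -!(@natr1 R k) -!(@natr1 R n).
have knR : k%:R <= n%:R :> R by rewrite ler_nat; lia.
have nkR : n%:R <= k%:R + k%:R + 1 :> R by rewrite -natrD natr1 ler_nat; lia.
have h1 := IHn k.+1 ltac:(lia); have h2 := IHn k ltac:(lia).
rewrite -!(@natr1 R k) -!(@natr1 R n) in h1 h2.
have := @ratio_step_le (eulerian n.+1 k.+2)%:R (eulerian n.+1 k.+1)%:R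
  (eulerian n.+1 k)%:R (k%:R + 2) (n%:R - k%:R) (ler0n _ _) _ _ _ _.
rewrite (_ : k%:R + 2 + 1 = k%:R + 1 + 2); last by lra.
rewrite (_ : n%:R - k%:R + 1 = n%:R + 1 - k%:R); last by lra.
rewrite (_ : n%:R + 1 + 1 - (k%:R + 1) = n%:R + 1 - k%:R); last by lra.
rewrite (_ : n%:R + 1 - (k%:R + 1) = n%:R - k%:R) in h1 *; last by lra.
apply => //; lra.
Qed.

(* The ratio is about [exp (- 6 d / n)] with [d = 2 k + 2 - n]; its linear
   truncation, lowered by [24 / n], is stable under the recurrence. It is
   vacuous when it is negative, so no cut-off at large [d] is needed. *)
Lemma eulerian_ratio_ge n k : (0 < n)%N -> (n <= k.*2.+2)%N ->
  (eulerian n k)%:R * (n%:R - (6 * (2 * k%:R + 2 - n%:R) + 24)) <=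
  (eulerian n k.+1)%:R * n%:R :> R.
Proof.
case: n => // n _; elim: n k => [|n IHn] k nk.
  apply: (@le_trans _ _ 0); last by rewrite mulr_ge0.
  have k0 := ler0n R k.
  by apply: mulr_ge0_le0 => //; lra.
have k0 := ler0n R k; have n0 := ler0n R n.
have [nk2|nk2] := eqVneq n k.*2.
  rewrite eulerian_middle //; apply: ler_wpM2l => //.
  by rewrite nk2 -addn2 -addnn !natrD; lra.
have [kn|kn] := leqP n.+2 k.
  by rewrite !eulerian_eq0 ?mul0r // ltnW.
case: k => [|k] in nk nk2 kn k0 *; first by lia.
rewrite !(@eulerian_succ_real n.+1) // -!(@natr1 R n.+1).
rewrite -!(@natr1 R k) -!(@natr1 R n).
have knR : k%:R <= n%:R :> R by rewrite ler_nat; lia.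
have nkR : n%:R <= k%:R + k%:R + 1 :> R by rewrite -natrD natr1 ler_nat; lia.
have h1 := IHn k.+1 ltac:(lia); have h2 := IHn k ltac:(lia).
rewrite -!(@natr1 R k) -!(@natr1 R n) in h1 h2 k0.
have := @ratio_step_ge (eulerian n.+1 k.+2)%:R (eulerian n.+1 k.+1)%:R
  (eulerian n.+1 k)%:R (k%:R + 2) (n%:R - k%:R) (n%:R + 1)
  (6 * (2 * k%:R + 2 - n%:R) + 24).
have a0 := ler0n R (eulerian n.+1 k.+2).
have b0 := ler0n R (eulerian n.+1 k.+1); have c0 := ler0n R (eulerian n.+1 k).
move: (eulerian n.+1 k.+2)%:R (eulerian n.+1 k.+1)%:R (eulerian n.+1 k)%:R
  a0 b0 c0 h1 h2 => a b c a0 b0 c0 h1 h2.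
move=> H; have {H} := H ltac:(lra) ltac:(lra) a0 b0 c0 ltac:(lra) ltac:(lra)
  ltac:(lra) ltac:(lra) ltac:(lra).
by lra.
Qed.

End Ratios.

(** * Mean and variance *)

Section Moments.
Variable R : realType.
Implicit Types n : nat.

Lemma sum_perm_descents_real n (f : nat -> R) : (0 < n)%N ->
  \sum_(s : 'S_n.+1) f (descents s) =
  \sum_(s : 'S_n) (((descents s)%:R + 1) * f (descents s)
                   + (n%:R - (descents s)%:R) * f (descents s).+1).
Proof.
move=> n0; rewrite sum_perm_descents //; apply: eq_bigr => s _.
rewrite -[X in X + _]mulr_natl -[X in _ + X]mulr_natl natrB ?natr1 //.
by rewrite ltnW ?descents_lt.
Qed.

Lemma sum_descents n : (0 < n)%N ->
  \sum_(s : 'S_n) (descents s)%:R = (n%:R - 1) / 2 * n`!%:R :> R.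
Proof.
case: n => // n _; elim: n => [|n IHn].
  rewrite subrr !mul0r big1 // => s _.
  by have := descents_lt s isT; rewrite ltnS leqn0 => /eqP ->.
rewrite (sum_perm_descents_real (fun d => d%:R)) //.
transitivity (\sum_(s : 'S_n.+1) (n.+1%:R * (descents s)%:R + n.+1%:R) : R).
  by apply: eq_bigr => s _; rewrite -natr1; lra.
rewrite big_split -mulr_sumr /= IHn sumr_const card_Sn.
by rewrite -(mulr_natr _ n.+1`!) [in RHS]factS natrM -(natr1 n.+1); field.
Qed.

(** The closed form fails at n = 1, so the induction starts at n = 2, where the coefficient m - 1 =
    0 removes the previous second moment. *)
Lemma sum_descents_sq n : (1 < n)%N ->
  \sum_(s : 'S_n) (descents s)%:R ^+ 2 =
  (3 * n%:R ^+ 2 - 5 * n%:R + 4) / 12 * n`!%:R :> R.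
Proof.
have rec m : (0 < m)%N -> \sum_(s : 'S_m.+1) (descents s)%:R ^+ 2 =
    (m%:R - 1) * \sum_(s : 'S_m) (descents s)%:R ^+ 2
    + (2 * m%:R - 1) * ((m%:R - 1) / 2 * m`!%:R) + m%:R * m`!%:R :> R.
  move=> m0; rewrite (sum_perm_descents_real (fun d => d%:R ^+ 2)) //.
  rewrite -sum_descents // !mulr_sumr.
  have -> : m%:R * m`!%:R = \sum_(s : 'S_m) m%:R :> R.
    by rewrite sumr_const card_Sn mulr_natr.
  rewrite -!big_split /=; apply: eq_bigr => s _.
  by rewrite -natr1; ring.
case: n => [|[|n]] // _; elim: n => [|n IHn].
  by rewrite rec // subrr !mul0r !factS fact0 muln1; field.
by rewrite rec // IHn [in RHS]factS natrM -(natr1 n.+2); field.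
Qed.

Lemma des_meanE n : (0 < n)%N -> des_mean R n = (n%:R - 1) / 2.
Proof.
move=> n0; rewrite /des_mean /perm_mean sum_descents //.
by rewrite cardsT card_Sn mulfK // pnatr_eq0 -lt0n fact_gt0.
Qed.

Lemma des_sdE n : (1 < n)%N -> des_sd R n = Num.sqrt ((n%:R + 1) / 12).
Proof.
move=> n1; have n0 := ltnW n1; rewrite /des_sd /perm_var; congr Num.sqrt.
rewrite {1}/perm_mean -/(des_mean R n) des_meanE // cardsT card_Sn.
have f0 : n`!%:R != 0 :> R by rewrite pnatr_eq0 -lt0n fact_gt0.
apply: (canLR (mulfK f0)).
under eq_bigr do rewrite sqrrB.
rewrite big_split /= sumrB sum_descents_sq // sumrMnl -mulr_suml.
rewrite sum_descents //.
rewrite sumr_const card_Sn -(mulr_natr _ n`!).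
by field.
Qed.

Lemma perm_prob_descents n k :
  perm_prob R [set s : 'S_n | (descents s)%:Z == k%:Z] =
  (eulerian n k)%:R / n`!%:R.
Proof. by rewrite /perm_prob cardsT card_Sn. Qed.

End Moments.

(** * Sums of Gaussian weights *)

Section GaussianSums.
Variable R : realType.
Implicit Types (m s t u : R) (n k : nat).
Local Notation mu := (@lebesgue_measure R).

Lemma normal_fun_le1 m s t : normal_fun m s t <= 1.
Proof.
rewrite -[leRHS]expR0 ler_expR mulNr oppr_le0.
by rewrite mulr_ge0 ?sqr_ge0 // invr_ge0 mulrn_wge0 ?sqr_ge0.
Qed.

Lemma ler_normal_fun m s t u : `|t - m| <= `|u - m| ->
  normal_fun m s u <= normal_fun m s t.
Proof.
move=> tu; rewrite ler_expR !mulNr lerN2 ler_wpM2r //.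
  by rewrite invr_ge0 mulrn_wge0 ?sqr_ge0.
by rewrite -[leLHS]real_normK ?num_real // -[leRHS]real_normK ?num_real //
  lerXn2r ?nnegrE.
Qed.

(* Total variation of [normal_fun m s] on ]-oo, t]; its telescoping sum bounds
   the distance between the sum over integers and the integral. *)
Definition normal_var m s t :=
  if t <= m then normal_fun m s t else 2 - normal_fun m s t.

Lemma normal_fun_dist m s t u : t <= u ->
  `|normal_fun m s t - normal_fun m s u| <= normal_var m s u - normal_var m s t.
Proof.
move=> tu; rewrite /normal_var.
have [tm|mt] := leP t m; have [um|mu'] := leP u m.
- rewrite distrC ger0_norm // subr_ge0 ler_normal_fun //.
  by rewrite !ler0_norm; lra.
- have := normal_fun_le1 m s t; have := normal_fun_le1 m s u.
  by rewrite ler_norml => ? ?; apply/andP; split; lra.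
- by lra.
- have -> : 2 - normal_fun m s u - (2 - normal_fun m s t) =
    normal_fun m s t - normal_fun m s u by ring.
  rewrite ger0_norm // subr_ge0 ler_normal_fun //.
  by rewrite !ger0_norm; lra.
Qed.

Lemma normal_var_dist_le2 m s t u : normal_var m s u - normal_var m s t <= 2.
Proof.
have := normal_fun_le1 m s t; have := normal_fun_le1 m s u.
have := normal_fun_ge0 m s t; have := normal_fun_ge0 m s u.
by rewrite /normal_var; case: ifP; case: ifP; lra.
Qed.

Lemma normal_prob_unit_itv m s t (a b : R) : 0 < s -> 0 <= a ->
  (forall x, t <= x < t + 1 -> a <= normal_fun m s x <= b) ->
  normal_peak s * a <= fine (normal_prob m s `[t, t + 1[%classic)
    <= normal_peak s * b.
Proof.
move=> s0 a0 ab.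
have p0 := normal_peak_ge0 s.
set I := `[t, t + 1[%classic.
have mI : measurable I by exact: measurable_itv.
have muI : mu I = 1%E.
  by rewrite lebesgue_measure_itv /= lte_fin ltrDl ltr01 -EFinB addrC addKr.
have cst_int (c : R) :
    (\int[mu]_(x in I) (normal_peak s * c)%:E = (normal_peak s * c)%:E)%E.
  by rewrite integral_cst // -[RHS]mule1; congr (_ * _)%E; exact: muI.
have pdfE x : normal_pdf m s x = normal_peak s * normal_fun m s x.
  by rewrite normal_pdfE // gt_eqF.
apply/andP; split; rewrite -lee_fin fineK ?fin_num_measure // -cst_int;
  apply: ge0_le_integral => //=.
- by move=> x _; rewrite lee_fin mulr_ge0.
- apply/measurable_realfun.measurable_EFinP; apply: measurable_funTS.
  exact: measurable_normal_pdf.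
- move=> x; rewrite /I /= in_itv /= => /ab /andP[h _].
  by rewrite lee_fin pdfE ler_wpM2l.
- by move=> x _; rewrite lee_fin normal_pdf_ge0.
- apply/measurable_realfun.measurable_EFinP; apply: measurable_funTS.
  exact: measurable_normal_pdf.
- move=> x; rewrite /I /= in_itv /= => /ab /andP[_ h].
  by rewrite lee_fin pdfE ler_wpM2l.
Qed.

Lemma normal_prob_itv_sum m s n :
  fine (normal_prob m s `[0, n%:R[%classic) =
  \sum_(0 <= k < n) fine (normal_prob m s `[k%:R, k%:R + 1[%classic).
Proof.
elim: n => [|n IHn].
  by rewrite big_geq // set_itvco0 measure0.
rewrite big_nat_recr //= -IHn -fineD ?fin_num_measure // -measureU //;
  last first.
  apply/seteqP; split => // x [] /=; rewrite !in_itv /=.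
  move=> /andP[_ h1] /andP[h2 _].
  by move: h1; rewrite ltNge h2.
congr (fine (normal_prob m s _)).
apply/seteqP; split => x /=; rewrite !in_itv /=.
  rewrite -natr1; case/andP => -> h.
  case: (ltP x n%:R) => [|h']; [by left|right].
  by rewrite h.
rewrite -natr1 => -[/andP[-> h]|/andP[h ->]] /=; first by lra.
by rewrite andbT (le_trans _ h).
Qed.

Lemma normal_sum_prob m s n : 0 < s ->
  `|(\sum_(0 <= k < n) normal_fun m s k%:R) -
    (normal_peak s)^-1 * fine (normal_prob m s `[0, n%:R[%classic)| <= 2.
Proof.
move=> s0; rewrite normal_prob_itv_sum mulr_sumr -sumrB.
apply: (le_trans _ (normal_var_dist_le2 m s 0 n%:R)).
have <- : \sum_(0 <= k < n) (normal_var m s k.+1%:R - normal_var m s k%:R) =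
    normal_var m s n%:R - normal_var m s 0.
  by rewrite (telescope_sumr (fun k => normal_var m s k%:R)).
apply: (le_trans (ler_norm_sum _ _ _)); apply: ler_sum => k _.
set d := normal_var _ _ _ - _.
have dk x : k%:R <= x < k%:R + 1 ->
    `|normal_fun m s k%:R - normal_fun m s x| <= d.
  move=> /andP[h1 h2]; apply: (le_trans (normal_fun_dist m s h1)).
  (* [normal_var] is nondecreasing, as its increments dominate an absolute value; so the variation
     up to [x] is at most that of the whole cell. *)
  rewrite lerD2r -natr1; have := normal_fun_dist m s (ltW h2).
  by move/(le_trans (normr_ge0 _)); rewrite subr_ge0.
have p0 : 0 < normal_peak s by rewrite normal_peak_gt0 // gt_eqF.
(* The lower constant is cut off at 0 because nonnegative integrals are compared. *)
have [] // := @andP _ _ (@normal_prob_unit_itv m s k%:R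
  (Num.max 0 (normal_fun m s k%:R - d)) (normal_fun m s k%:R + d) s0 _ _).
- by rewrite le_max lexx.
- move=> x /dk; rewrite ler_norml => h; rewrite ge_max normal_fun_ge0 /=.
  by apply/andP; split; lra.
rewrite -!(ler_pdivrMl _ _ p0) -!(ler_pdivlMl _ _ p0) ge_max => /andP[_ h1] h2.
by rewrite ler_norml; apply/andP; split; lra.
Qed.

Lemma normal_peakVE s : 0 < s -> (normal_peak s)^-1 = Num.sqrt (2 * pi) * s.
Proof.
move=> s0; rewrite /normal_peak invrK -mulr_natl mulrCA sqrtrM ?sqr_ge0 //.
by rewrite sqrtr_sqr gtr0_norm // mulrC.
Qed.

(* Off the bulk, half of the exponent of the density already gives the decay;
   the other part is a Gaussian density with twice the deviation. *)
Lemma normal_prob_tail m s L (A : set R) : 0 < s -> measurable A -> 0 <= L ->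
  (forall t, A t -> L <= `|t - m|) ->
  fine (normal_prob m s A) <= 2 * expR (- (3 * L ^+ 2 / (8 * s ^+ 2))).
Proof.
move=> s0 mA L0 AL; set e := expR _.
have s20 : 0 < 2 * s by lra.
have e0 : 0 <= 2 * e by rewrite mulr_ge0 ?expR_ge0.
have pdf_le t : A t -> normal_pdf m s t <= 2 * e * normal_pdf m (2 * s) t.
  move=> /AL tL; rewrite !normal_pdfE ?gt_eqF //.
  have -> : normal_peak s = 2 * normal_peak (2 * s).
    rewrite -[LHS]invrK -[normal_peak (2 * s)]invrK !normal_peakVE //.
    by field; rewrite !gt_eqF // sqrtr_gt0 mulr_gt0 ?pi_gt0.
  rewrite -!mulrA ler_wpM2l // mulrCA ler_wpM2l ?normal_peak_ge0 //.
  rewrite /normal_fun -expRD ler_expR -[X in 8 * X]/(s ^+ 2).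
  (* Splits 1/2 = 3/8 + 1/8; the part 1/8 is the exponent for deviation [2 * s]. *)
  have -> : - (t - m) ^+ 2 / (s ^+ 2 *+ 2) =
      - (3 * (t - m) ^+ 2 / (8 * s ^+ 2))
      + - (t - m) ^+ 2 / ((2 * s) ^+ 2 *+ 2).
    by field; rewrite gt_eqF.
  rewrite lerD2r lerN2 ler_wpM2r ?invr_ge0 ?mulr_ge0 ?sqr_ge0 ?(ltW s0) //.
  rewrite ler_wpM2l // -[leRHS]real_normK ?num_real //.
  by rewrite lerXn2r ?nnegrE.
apply: (@le_trans _ _ (2 * e * fine (normal_prob m (2 * s) A))); last first.
  rewrite ler_piMr // -lee_fin fineK ?fin_num_measure //.
  exact: probability_le1.
rewrite -lee_fin EFinM !fineK ?fin_num_measure // /normal_prob.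
rewrite -ge0_integralZl_EFin //; first last.
- apply/measurable_realfun.measurable_EFinP; apply: measurable_funTS.
  exact: measurable_normal_pdf.
- by move=> x _; rewrite lee_fin normal_pdf_ge0.
apply: ge0_le_integral => //.
- by move=> x _; rewrite lee_fin normal_pdf_ge0.
- apply/measurable_realfun.measurable_EFinP; apply: measurable_funTS.
  exact: measurable_normal_pdf.
- apply: measurable_funeM; apply/measurable_realfun.measurable_EFinP.
  apply: measurable_funTS.
  exact: measurable_normal_pdf.
Qed.

Lemma normal_sum_le m s n : 0 < s ->
  \sum_(0 <= k < n) normal_fun m s k%:R <= Num.sqrt (2 * pi) * s + 2.
Proof.
move=> s0; have := normal_sum_prob m n s0; rewrite normal_peakVE // ler_norml.
set P := fine _; case/andP => _.
have P1 : P <= 1.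
  by rewrite -lee_fin fineK ?fin_num_measure //; exact: probability_le1.
have : Num.sqrt (2 * pi) * s * P <= Num.sqrt (2 * pi) * s.
  by rewrite ler_piMr // mulr_ge0 ?sqrtr_ge0 // ltW.
by lra.
Qed.

(** The hypotheses on [L] put all points closer than [L] to [m] inside [0, n[, so the mass missing
    from the integral is a tail. *)
Lemma normal_sum_ge m s n L : 0 < s -> 0 <= L ->
  L <= m -> m + L <= n%:R ->
  Num.sqrt (2 * pi) * s * (1 - 2 * expR (- (3 * L ^+ 2 / (8 * s ^+ 2)))) - 2 <=
  \sum_(0 <= k < n) normal_fun m s k%:R.
Proof.
move=> s0 L0 Lm mLn; have := normal_sum_prob m n s0.
rewrite normal_peakVE // ler_norml => /andP[h _].
have mI : measurable `[0, n%:R : R[%classic by exact: measurable_itv.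
have := @normal_prob_tail m s L (~` `[0, n%:R[%classic) s0 (measurableC mI) L0.
rewrite probability_setC // fineB ?fin_num_measure //= => tail.
have {}tail := tail _.
have t1 : 1 - fine (normal_prob m s `[0, n%:R[%classic) <=
    2 * expR (- (3 * L ^+ 2 / (8 * s ^+ 2))).
  apply: tail => t /=; rewrite in_itv /= => /negP.
  rewrite negb_and -ltNge -leNgt => /orP[t0|tn].
    by rewrite ler0_norm; lra.
  by rewrite ger0_norm; lra.
have : Num.sqrt (2 * pi) * s * (1 - 2 * expR (- (3 * L ^+ 2 / (8 * s ^+ 2)))) <=
    Num.sqrt (2 * pi) * s * fine (normal_prob m s `[0, n%:R[%classic).
  by apply: ler_wpM2l; [rewrite mulr_ge0 ?sqrtr_ge0 ?ltW | lra].
by lra.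
Qed.

End GaussianSums.

(** * Elementary bounds on the exponential *)

Section ExpBounds.
Variable R : realType.
Implicit Types v t e : R.

(** This is artanh v >= v in a form without singularity. Multiplied by exp v, it compares two
    functions equal at 0 whose difference has derivative x (exp x - exp (- x)) >= 0. *)
Lemma expR_ratio_ge v : 0 <= v -> 1 - v <= (1 + v) * expR (- (2 * v)).
Proof.
move=> v0.
pose f (x : R) : R := (1 + x) * expR (- x) - (1 - x) * expR x.
pose df (x : R) : R := x * (expR x - expR (- x)).
have fdf (x : R) : is_derive x (1 : R) f (df x).
  rewrite /f; apply: is_derive_eq.
  by rewrite /df /GRing.scale /=; ring.
have cf : {within `[0, v], continuous f}%classic.
  apply: derivable_within_continuous => x _.
  by apply: ex_derive.
have [c /[!in_itv] /= /andP[c0 _]] := MVT_segment v0 (fun x _ => fdf x) cf.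
have -> : f 0 = 0 by rewrite /f subr0 addr0 oppr0 subrr.
rewrite !subr0 => fE.
have : 0 <= f v.
  rewrite fE /df !mulr_ge0 // subr_ge0 ler_expR; lra.
rewrite /f subr_ge0 -(ler_pM2r (expR_gt0 (- v))) -!mulrA -!expRD subrr expR0.
by rewrite mulr1 (_ : - v - v = - (2 * v)) //; ring.
Qed.

(** From exp t >= (1 + t/2)^2: with the coefficient 3/4 the terms in t and t^2 of the product
    cancel, leaving 1 + t^3/2 + 3 t^4/16. *)
Lemma expRN_le t : 0 <= t -> expR (- t) <= 1 - t + 3 / 4 * t ^+ 2.
Proof.
move=> t0.
have h : 1 + t / 2 <= expR (t / 2) by exact: expR_ge1Dx.
have e2 : expR t = expR (t / 2) ^+ 2 by rewrite expr2 -expRD -splitr.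
have h2 : (1 + t / 2) ^+ 2 <= expR t.
  by rewrite e2 lerXn2r ?nnegrE ?expR_ge0 //; lra.
rewrite expRN -[leLHS]mul1r ler_pdivrMr ?expR_gt0 //.
have p0 : 0 <= 1 - t + 3 / 4 * t ^+ 2.
  by have := sqr_ge0 (t - 2 / 3); rewrite !expr2; lra.
apply: le_trans (ler_wpM2l p0 h2).
have := exprn_ge0 2 t0; have := exprn_ge0 3 t0; have := exprn_ge0 4 t0.
by rewrite !exprS !expr0; lra.
Qed.

Lemma expR_le1DM t : 0 <= t -> expR t <= 1 + t * expR t.
Proof.
move=> t0; have := expR_ge1Dx (- t); rewrite expRN => h.
have := ler_wpM2r (expR_ge0 t) h; rewrite mulVf ?gt_eqF ?expR_gt0 //.
by lra.
Qed.

(** Half of the Gaussian exponent absorbs a cubic factor, since exp (3 t^2) >= (1 + 3 t^2/2)^2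
    already exceeds t^3 + t. *)
Lemma gauss_cubic_le t : 0 <= t ->
  expR (- (6 * t ^+ 2)) * (t ^+ 3 + t) <= expR (- (3 * t ^+ 2)).
Proof.
move=> t0.
have -> : expR (- (6 * t ^+ 2)) = expR (- (3 * t ^+ 2)) * expR (- (3 * t ^+ 2)).
  by rewrite -expRD; congr expR; ring.
rewrite -mulrA ler_piMr ?expR_ge0 // expRN mulrC ler_pdivrMr ?expR_gt0 // mul1r.
have t20 := sqr_ge0 t.
have h : 1 + 3 / 2 * t ^+ 2 <= expR (3 / 2 * t ^+ 2) by exact: expR_ge1Dx.
have -> : expR (3 * t ^+ 2) = expR (3 / 2 * t ^+ 2) ^+ 2.
  by rewrite (expr2 (expR _)) -expRD; congr expR; field.
have h2 : (1 + 3 / 2 * t ^+ 2) ^+ 2 <= expR (3 / 2 * t ^+ 2) ^+ 2.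
  by rewrite lerXn2r ?nnegrE ?expR_ge0 //; lra.
apply: le_trans h2.
have := sqr_ge0 (t - 1); have := mulr_ge0 t20 (sqr_ge0 (t - 1)).
have := mulr_ge0 t20 t20.
by rewrite !exprS !expr0; lra.
Qed.

(** Turns the linear bound of [eulerian_ratio_ge] into an exponential with relative loss [e]. The
    condition [e <= 1] forces [d <= n], so that 6 d/n and 6 d/(n + 1) differ by at most 6/n. *)
Lemma lower_ratio (n d : R) (e := (42 * d ^+ 2 + 45 * n) / n ^+ 2) :
  1 <= n -> 0 <= d -> e <= 1 ->
  expR (- (6 * d / (n + 1))) * (1 - e) <= 1 - (6 * d + 24) / n.
Proof.
move=> n1 d0 e1.
have n0 : 0 < n by lra.
have dn : d <= n.
  move: e1; rewrite /e ler_pdivrMr ?exprn_gt0 // mul1r => h.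
  have : d ^+ 2 <= n ^+ 2 by have := sqr_ge0 d; lra.
  by rewrite ler_sqr ?nnegrE // ltW.
set t := 6 * d / (n + 1).
have t0 : 0 <= t by rewrite divr_ge0 //; lra.
apply: (le_trans (ler_wpM2r _ (expRN_le t0))); first by rewrite subr_ge0.
have e0 : 0 <= e.
  by rewrite divr_ge0 ?sqr_ge0 // addr_ge0 ?mulr_ge0 ?sqr_ge0 // ltW.
have k1 : 2 / 3 * e <= (1 - t + 3 / 4 * t ^+ 2) * e.
  apply: ler_wpM2r => //.
  by have := sqr_ge0 (t - 2 / 3); rewrite !expr2; lra.
(* The quadratic of [expRN_le] has minimum 2/3. The left side is at most 27 (d/n)^2 + 30/n, and 42
   and 45 are 3/2 times 28 and 30. *)
suff : 3 / 4 * t ^+ 2 + (6 * d / n - t) + 24 / n <= 2 / 3 * e.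
  rewrite mulrDl; lra.
have tle : t <= 6 * d / n.
  by rewrite /t ler_wpM2l ?mulr_ge0 // lef_pV2 ?posrE //; lra.
have t2 : t ^+ 2 <= (6 * d / n) ^+ 2.
  by rewrite lerXn2r ?nnegrE // (le_trans t0).
have tdiff : 6 * d / n - t <= 6 / n.
  have -> : 6 * d / n - t = d / (n + 1) * (6 / n).
    by rewrite /t; field; rewrite !gt_eqF //; lra.
  have d1 : d / (n + 1) <= 1 by rewrite ler_pdivrMr; lra.
  by apply: ler_piMl d1; rewrite divr_ge0 //; lra.
have -> : 2 / 3 * e = 28 * (d / n) ^+ 2 + 30 / n.
  by rewrite /e; field; rewrite gt_eqF.
have : (6 * d / n) ^+ 2 = 36 * (d / n) ^+ 2 by rewrite -mulrA exprMn; ring.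
have := sqr_ge0 (d / n).
move: tdiff; lra.
Qed.
End ExpBounds.

(** * Gaussian approximation up to normalization *)

Section LocalBounds.
Variable R : realType.
Implicit Types n k j : nat.

Definition dev n k : R := k%:R - (n%:R - 1) / 2.

Definition gauss n k : R := expR (- (6 * dev n k ^+ 2 / (n%:R + 1))).

(* Chosen so that [amplitude n * gauss n k] and the Eulerian numbers agree at
   the central index [k = n./2]. *)
Definition amplitude n : R :=
  (eulerian n n./2)%:R * expR (6 * dev n n./2 ^+ 2 / (n%:R + 1)).

(** The increment is the [d] of the ratio bounds, so products of the factors exp (- 6 d/(n + 1))
    telescope to a Gaussian. *)
Lemma dev_sqS n k : dev n k.+1 ^+ 2 = dev n k ^+ 2 + (2 * k%:R + 2 - n%:R).
Proof. by rewrite /dev -natr1; field. Qed.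

Lemma half_real n : n%:R <= 2 * n./2%:R + 1 :> R /\ 2 * n./2%:R <= n%:R :> R.
Proof. by split; rewrite -natrM ?natr1 ler_nat; lia. Qed.

Lemma eulerian_le_center n j : (0 < n)%N ->
  (eulerian n (n./2 + j))%:R <= (eulerian n n./2)%:R *
    expR (- (6 * (dev n (n./2 + j) ^+ 2 - dev n n./2 ^+ 2) / (n%:R + 2))) :> R.
Proof.
move=> n0; elim: j => [|j IHj].
  by rewrite addn0 subrr mulr0 mul0r oppr0 expR0 mulr1.
rewrite addnS; set k := (n./2 + j)%N in IHj *.
have [kn|kn] := leqP n k.+1.
  by rewrite (eulerian_eq0 (k := k.+1)) // mulr_ge0 // expR_ge0.
have knR : k%:R + 1 <= n%:R :> R by rewrite natr1 ler_nat ltnW.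
have k0 := ler0n R k.
have nk : n%:R <= 2 * k%:R + 1 :> R by rewrite -natrM natr1 ler_nat /k; lia.
(* Chosen so that (1 - v)/(1 + v) = (n - k)/(k + 2). *)
set v : R := (2 * k%:R + 2 - n%:R) / (n%:R + 2).
have n2 : 0 < n%:R + 2 :> R by rewrite ltr_wpDl.
have v0 : 0 <= v by rewrite divr_ge0 //; lra.
have h1 : n%:R - k%:R <= (k%:R + 2) * expR (- (2 * v)).
  have := expR_ratio_ge v0.
  have -> : 1 - v = (n%:R - k%:R) * (2 / (n%:R + 2)).
    by rewrite /v; field; rewrite gt_eqF.
  have -> : 1 + v = (k%:R + 2) * (2 / (n%:R + 2)).
    by rewrite /v; field; rewrite gt_eqF.
  by rewrite mulrAC ler_pM2r // divr_gt0.
have h3 : (n%:R - k%:R) ^+ 3 <= (k%:R + 2) ^+ 3 * expR (- (6 * v)).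
  have -> : expR (- (6 * v)) = expR (- (2 * v)) ^+ 3.
    by rewrite -expRM_natr; congr expR; ring.
  rewrite -exprMn lerXn2r ?nnegrE ?mulr_ge0 ?expR_ge0 //; lra.
have ratio : (eulerian n k.+1)%:R <= (eulerian n k)%:R * expR (- (6 * v)) :> R.
  have k2 : 0 < (k%:R + 2) ^+ 3 :> R by rewrite exprn_gt0 // ltr_wpDl.
  rewrite -(ler_pM2r k2); apply: (le_trans (eulerian_ratio_le R n0 _)).
    by rewrite /k; lia.
  by rewrite -mulrA ler_wpM2l // mulrC.
apply: (le_trans ratio); apply: (le_trans (ler_wpM2r (expR_ge0 _) IHj)).
rewrite -[leLHS]mulrA -expRD dev_sqS ler_wpM2l // ler_expR /v le_eqVlt.
apply/orP; left.
by apply/eqP; field; rewrite gt_eqF.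
Qed.

(** Each step outwards costs a factor 1 - e, and (1 - j e')(1 - e) >= 1 - (j + 1) e because the
    losses grow with the distance. A bound that is not positive is trivial; otherwise [e <= 1], as
    [lower_ratio] requires. *)
Lemma eulerian_ge_center n j : (0 < n)%N ->
  (eulerian n n./2)%:R *
    expR (- (6 * (dev n (n./2 + j) ^+ 2 - dev n n./2 ^+ 2) / (n%:R + 1))) *
  (1 - j%:R * ((42 * (2 * (n./2 + j)%:R - n%:R) ^+ 2 + 45 * n%:R) / n%:R ^+ 2))
  <= (eulerian n (n./2 + j))%:R :> R.
Proof.
move=> n0; have n1R : 1 <= n%:R :> R by rewrite ler1n.
have n0R : 0 < n%:R :> R by rewrite ltr0n.
elim: j => [|j IHj].
  by rewrite addn0 subrr mulr0 mul0r oppr0 expR0 mul0r subr0 !mulr1.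
rewrite addnS; set k := (n./2 + j)%N in IHj *.
have k0 := ler0n R k.
have nk2 : (n <= k.*2.+2)%N by rewrite /k; lia.
have nk : n%:R <= 2 * k%:R + 1 :> R by rewrite -natrM natr1 ler_nat /k; lia.
set d : R := 2 * k.+1%:R - n%:R.
have dE : d = 2 * k%:R + 2 - n%:R by rewrite /d -natr1; ring.
have d1 : 1 <= d by lra.
set e' : R := (42 * (2 * k%:R - n%:R) ^+ 2 + 45 * n%:R) / n%:R ^+ 2 in IHj.
set e : R := (42 * d ^+ 2 + 45 * n%:R) / n%:R ^+ 2.
(* At the centre 2 k - n can be -1, so absolute values are compared. *)
have e'e : e' <= e.
  rewrite /e /e' ler_wpM2r ?invr_ge0 ?sqr_ge0 // lerD2r ler_wpM2l //.
  rewrite -[leLHS]real_normK ?num_real // lerXn2r ?nnegrE //.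
    by apply: le_trans d1.
  by rewrite ler_norml; apply/andP; split; lra.
have e'0 : 0 <= e'.
  by rewrite divr_ge0 ?sqr_ge0 //; have := sqr_ge0 (2 * k%:R - n%:R : R); lra.
have e0 : 0 <= e.
  by rewrite divr_ge0 ?sqr_ge0 //; have := sqr_ge0 d; lra.
have j0 := ler0n R j.
have [big|small] := lerP (1 - j.+1%:R * e) 0.
  apply: (@le_trans _ _ 0); last by [].
  by rewrite mulr_ge0_le0 // mulr_ge0 ?expR_ge0.
have je' : j%:R * e' <= j%:R * e by exact: ler_wpM2l.
have je0 : 0 <= j%:R * e by exact: mulr_ge0.
rewrite -natr1 mulrDl mul1r in small *.
have e1 : e <= 1 by lra.
have ratio : (eulerian n k)%:R * (1 - (6 * d + 24) / n%:R) <=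
    (eulerian n k.+1)%:R :> R.
  rewrite -(ler_pM2r n0R) -mulrA mulrBl mul1r divfK ?gt_eqF //.
  by rewrite dE; exact: eulerian_ratio_ge.
have step := lower_ratio n1R (le_trans ler01 d1) e1.
apply: le_trans ratio; apply: (le_trans _ (ler_wpM2l _ step)) => //.
set X := expR (- (6 * d / _)).
have e1' : 0 <= 1 - e by lra.
apply: (@le_trans _ _ (((eulerian n n./2)%:R *
   expR (- (6 * (dev n k ^+ 2 - dev n n./2 ^+ 2) / (n%:R + 1))) *
   (1 - j%:R * e')) * (X * (1 - e)))); last first.
  by apply: ler_wpM2r IHj; rewrite mulr_ge0 ?expR_ge0.
rewrite dev_sqS.
have -> : expR (- (6 * (dev n k ^+ 2 + (2 * k%:R + 2 - n%:R)
    - dev n n./2 ^+ 2) / (n%:R + 1))) =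
    expR (- (6 * (dev n k ^+ 2 - dev n n./2 ^+ 2) / (n%:R + 1))) * X.
  rewrite /X -expRD dE; congr expR; field.
  by rewrite gt_eqF // ltr_wpDl.
set Y := expR (- (6 * (dev n k ^+ 2 - dev n n./2 ^+ 2) / _)).
rewrite -!mulrA ler_wpM2l // ler_wpM2l ?expR_ge0 // [leRHS]mulrCA.
rewrite ler_wpM2l ?expR_ge0 //.
have : 0 <= j%:R * e' * e.
  by rewrite mulr_ge0 // mulr_ge0.
by lra.
Qed.
End LocalBounds.

Section LocalLimit.
Variable R : realType.
Implicit Types n k j : nat.

Definition wide_gauss n k : R := expR (- (3 * dev R n k ^+ 2 / (n%:R + 1))).

Lemma amplitude_gauss n k : amplitude R n * gauss R n k =
  (eulerian n n./2)%:R *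
    expR (- (6 * (dev R n k ^+ 2 - dev R n n./2 ^+ 2) / (n%:R + 1))).
Proof.
rewrite /amplitude /gauss -mulrA -expRD; congr (_ * expR _).
by field; rewrite gt_eqF // ltr_wpDl.
Qed.

Lemma dev_rev n k : (k < n)%N -> dev R n (n.-1 - k) = - dev R n k.
Proof.
case: n => // n kn; rewrite /dev /= natrB // -natr1.
by field.
Qed.

Lemma eulerian_rev n k : (k < n)%N -> eulerian n (n.-1 - k) = eulerian n k.
Proof. by case: n => // n kn; rewrite eulerian_sym. Qed.

Lemma amplitude_ge0 n : 0 <= amplitude R n.
Proof. by rewrite mulr_ge0 ?expR_ge0. Qed.

Lemma eulerian_gauss_dist_half n k : (n./2 <= k)%N -> (k < n)%N ->
  `|(eulerian n k)%:R - amplitude R n * gauss R n k| <=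
  (700 + 3 * expR 2) * (amplitude R n * gauss R n k) *
  (`|dev R n k| ^+ 3 / (n%:R + 1) ^+ 2 + `|dev R n k| / (n%:R + 1)).
Proof.
move=> ck kn; have n0 : (0 < n)%N by apply: leq_ltn_trans kn.
have [c1 c2] := half_real R n.
have kE : (n./2 + (k - n./2) = k)%N by rewrite subnKC.
have up := eulerian_le_center R (k - n./2) n0.
have lo := eulerian_ge_center R (k - n./2) n0.
rewrite kE in up lo; rewrite -amplitude_gauss in lo.
set aG := amplitude R n * gauss R n k in lo *.
have aG0 : 0 <= aG by rewrite mulr_ge0 ?amplitude_ge0 ?expR_ge0.
have knR : k%:R + 1 <= n%:R :> R by rewrite natr1 ler_nat.
have ckR : n./2%:R <= k%:R :> R by rewrite ler_nat.
have n1R : 1 <= n%:R :> R by rewrite ler1n.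
have jE : (k - n./2)%:R = k%:R - n./2%:R :> R by rewrite natrB.
set W := dev R n k in up lo *.
have WE : W = k%:R - (n%:R - 1) / 2 by [].
have W0 : 0 <= W by lra.
have jW : (k - n./2)%:R <= W by lra.
rewrite (ger0_norm W0).
set N : R := n%:R + 1.
have N0 : 0 < N by rewrite /N; lra.
have e20 := expR_gt0 (2 : R).
have T1 : 0 <= W ^+ 3 / N ^+ 2 by rewrite divr_ge0 ?exprn_ge0 // ltW.
have T2 : 0 <= W / N by rewrite divr_ge0 // ltW.
have A1 := mulr_ge0 aG0 T1; have A2 := mulr_ge0 aG0 T2.
have A3 := mulr_ge0 (ltW e20) A1; have A4 := mulr_ge0 (ltW e20) A2.
rewrite ler_norml; apply/andP; split.
  (* At most [W] steps are taken, and 1/n <= 2/N gives 672 = 42 * 4 * 4 and 90 = 45 * 2. *)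
  have E_le : (k - n./2)%:R *
      ((42 * (2 * k%:R - n%:R) ^+ 2 + 45 * n%:R) / n%:R ^+ 2) <=
      672 * (W ^+ 3 / N ^+ 2) + 90 * (W / N).
    have nN : N <= 2 * n%:R by rewrite /N; lra.
    have n0R : 0 < n%:R :> R by lra.
    have iN : (n%:R)^-1 <= 2 * N^-1.
      rewrite -[leRHS]invrK invfM invrK.
      by rewrite lef_pV2 ?posrE ?mulr_gt0 ?invr_gt0 //; lra.
    have iN0 : 0 <= N^-1 by rewrite invr_ge0 ltW.
    have in0 : 0 <= (n%:R)^-1 :> R by rewrite invr_ge0 ltW.
    have jd : (k - n./2)%:R * (2 * k%:R - n%:R) ^+ 2 <= 4 * W ^+ 3.
      (* Away from the centre [W >= 1], which makes (2 W - 1)^2 <= 4 W^2; at the centre [W] may be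
         0, but the left side vanishes. *)
      have [->|j1] := posnP (k - n./2).
        by rewrite mul0r mulr_ge0 ?exprn_ge0.
      have W1 : 1 <= W by apply: le_trans jW; rewrite ler1n.
      have dW : (2 * k%:R - n%:R) ^+ 2 <= 4 * W ^+ 2.
        have -> : 2 * k%:R - n%:R = 2 * W - 1 :> R by rewrite WE; field.
        by rewrite !expr2; lra.
      have -> : 4 * W ^+ 3 = W * (4 * W ^+ 2) by ring.
      by apply: ler_pM; rewrite ?sqr_ge0.
    have -> : (k - n./2)%:R *
        ((42 * (2 * k%:R - n%:R) ^+ 2 + 45 * n%:R) / n%:R ^+ 2) =
      42 * ((k - n./2)%:R * (2 * k%:R - n%:R) ^+ 2) * (n%:R)^-1 ^+ 2
        + 45 * (k - n./2)%:R / n%:R :> R.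
      by field; rewrite gt_eqF.
    have i2 : (n%:R)^-1 ^+ 2 <= (2 * N^-1) ^+ 2.
      by rewrite lerXn2r ?nnegrE ?mulr_ge0.
    have -> : 672 * (W ^+ 3 / N ^+ 2) = 42 * (4 * W ^+ 3) * (2 * N^-1) ^+ 2.
      by field; rewrite gt_eqF.
    apply: lerD.
      apply: (ler_pM _ _ _ i2); last by rewrite ler_wpM2l.
        by rewrite mulr_ge0 // mulr_ge0 // sqr_ge0.
      exact: sqr_ge0.
    have -> : 90 * (W / N) = 45 * W * (2 * N^-1) by ring.
    by apply: (ler_pM _ _ _ iN) => //; rewrite ler_wpM2l.
  have := ler_wpM2l aG0 E_le.
  by move: lo; set E := _ * (_ / _); lra.
(* The cost of replacing n + 2 by n + 1 in the exponent of the upper bound. *)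
set z := 6 * W ^+ 2 / (N * (n%:R + 2)).
have M0 : 0 < N * (n%:R + 2) by rewrite mulr_gt0 //; lra.
have z0 : 0 <= z by rewrite divr_ge0 ?mulr_ge0 ?sqr_ge0 // ltW.
have Wn : 2 * W <= n%:R + 1 by lra.
have z2 : z <= 2.
  rewrite /z ler_pdivrMr //.
  have : (2 * W) ^+ 2 <= N ^+ 2 by rewrite lerXn2r ?nnegrE //; lra.
  by have := sqr_ge0 (n%:R : R); rewrite /N; lra.
have zW : z <= 3 * (W / N).
  have -> : z = W / N * (6 * W / (n%:R + 2)).
    by rewrite /z; field; rewrite !gt_eqF //; lra.
  rewrite mulrC ler_wpM2r // ler_pdivrMr; lra.
have upz : (eulerian n k)%:R <= aG * expR z.
  apply: (le_trans up); rewrite /aG amplitude_gauss -[leRHS]mulrA -expRD.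
  rewrite ler_wpM2l // ler_expR -/W -/N.
  set V := dev R n n./2.
  have -> : - (6 * (W ^+ 2 - V ^+ 2) / (n%:R + 2)) =
      - (6 * (W ^+ 2 - V ^+ 2) / N) + z - 6 * V ^+ 2 / (N * (n%:R + 2)).
    by rewrite /z /N; field; rewrite !gt_eqF //; lra.
  rewrite gerBl; apply: divr_ge0 (ltW M0).
  by rewrite mulr_ge0 // sqr_ge0.
have ez : expR z <= 1 + 3 * (W / N) * expR 2.
  apply: (le_trans (expR_le1DM z0)); rewrite lerD2l.
  by apply: ler_pM; rewrite ?expR_ge0 ?ler_expR.
have := ler_wpM2l aG0 ez.
by lra.
Qed.

Lemma eulerian_gauss_dist n k : (k < n)%N ->
  `|(eulerian n k)%:R - amplitude R n * gauss R n k| <=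
  (700 + 3 * expR 2) * (amplitude R n * gauss R n k) *
  (`|dev R n k| ^+ 3 / (n%:R + 1) ^+ 2 + `|dev R n k| / (n%:R + 1)).
Proof.
move=> kn; have [ck|kc] := leqP n./2 k; first exact: eulerian_gauss_dist_half.
have := @eulerian_gauss_dist_half n (n.-1 - k).
by rewrite /gauss eulerian_rev // dev_rev // sqrrN normrN; apply; lia.
Qed.

(** In the unit t = |dev|/sqrt (n + 1) the relative error is (t^3 + t)/sqrt (n + 1), and
    [gauss_cubic_le] applies. *)
Lemma gauss_dist_wide n k :
  gauss R n k *
  (`|dev R n k| ^+ 3 / (n%:R + 1) ^+ 2 + `|dev R n k| / (n%:R + 1)) <=
  wide_gauss n k / Num.sqrt (n%:R + 1).
Proof.
set N : R := n%:R + 1; have N0 : 0 < N by rewrite ltr_wpDl.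
have r0 : 0 < Num.sqrt N by rewrite sqrtr_gt0.
set r := Num.sqrt N in r0 *; have rE : N = r ^+ 2 by rewrite sqr_sqrtr // ltW.
set t := `|dev R n k| / r.
have t0 : 0 <= t by rewrite divr_ge0 // ltW.
have t2 : t ^+ 2 = dev R n k ^+ 2 / N.
  by rewrite expr_div_n real_normK ?num_real // rE.
rewrite ler_pdivlMr // -mulrA /gauss /wide_gauss -/N.
have tE c : c * dev R n k ^+ 2 / N = c * t ^+ 2 by rewrite t2 mulrA.
rewrite !tE.
have -> : (`|dev R n k| ^+ 3 / N ^+ 2 + `|dev R n k| / N) * r = t ^+ 3 + t.
  by rewrite rE /t; field; rewrite gt_eqF.
exact: gauss_cubic_le.
Qed.

End LocalLimit.

(** * Normalization and the local limit *)

Section Assembly.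
Variable R : realType.
Implicit Types n k : nat.

Definition sd n : R := Num.sqrt ((n%:R + 1) / 12).

Lemma sd_sq n : sd n ^+ 2 = (n%:R + 1) / 12.
Proof. by rewrite sqr_sqrtr // divr_ge0 // addr_ge0. Qed.

Lemma sd_gt0 n : 0 < sd n.
Proof. by rewrite sqrtr_gt0 divr_gt0 // ltr_wpDl. Qed.

Lemma gauss_normal n k : gauss R n k = normal_fun ((n%:R - 1) / 2) (sd n) k%:R.
Proof.
rewrite /gauss /normal_fun -/(dev R n k) sd_sq; congr expR.
by field; rewrite gt_eqF // ltr_wpDl.
Qed.

Lemma wide_gauss_normal n k :
  wide_gauss R n k = normal_fun ((n%:R - 1) / 2) (Num.sqrt 2 * sd n) k%:R.
Proof.
rewrite /wide_gauss /normal_fun -/(dev R n k) exprMn sqr_sqrtr // sd_sq.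
by congr expR; field; rewrite gt_eqF // ltr_wpDl.
Qed.

Local Notation kappa := (Num.sqrt (2 * pi) : R).

Lemma kappa_gt0 : 0 < kappa.
Proof. by rewrite sqrtr_gt0 mulr_gt0 // pi_gt0. Qed.

Lemma sum_gauss_dist n : (0 < n)%N ->
  `|\sum_(0 <= k < n) gauss R n k - kappa * sd n| <= 2 + 2 * kappa * expR 4.
Proof.
move=> n0; have n1R : 1 <= n%:R :> R by rewrite ler1n.
have s0 := sd_gt0 n; have k0 := kappa_gt0.
under eq_bigr do rewrite gauss_normal.
have up := normal_sum_le ((n%:R - 1) / 2) n s0.
have L0 : 0 <= (n%:R - 1) / 2 :> R by lra.
have lo := @normal_sum_ge R ((n%:R - 1) / 2) (sd n) n _ s0 L0 (lexx _)
  ltac:(lra).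
have N0 : 0 < n%:R + 1 :> R by lra.
have tail : sd n * expR (- (3 * ((n%:R - 1) / 2) ^+ 2 / (8 * sd n ^+ 2))) <=
    expR 4.
  rewrite sd_sq.
  (* The exponent is 9/8 (n - 1)^2/(n + 1), at least n - 3 because (n - 3)(n + 1) = (n - 1)^2 - 4;
     then exp (n + 1) beats [sd n]. *)
  apply: (@le_trans _ _ (sd n * expR (4 - (n%:R + 1)))).
    rewrite ler_wpM2l ?(ltW s0) // ler_expR lerNl opprB.
    have -> : 3 * ((n%:R - 1) / 2) ^+ 2 / (8 * ((n%:R + 1) / 12)) =
        9 / 8 * (n%:R - 1) ^+ 2 / (n%:R + 1) :> R.
      by field; rewrite gt_eqF.
    rewrite ler_pdivlMr //.
    by have := sqr_ge0 (n%:R - 1 : R); rewrite !expr2; lra.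
  rewrite expRD mulrCA -[leRHS]mulr1 ler_wpM2l ?expR_ge0 //.
  rewrite expRN ler_pdivrMr ?expR_gt0 // mul1r.
  apply: (le_trans _ (expR_ge1Dx _)).
  have : sd n ^+ 2 <= (1 + (n%:R + 1)) ^+ 2.
    rewrite sd_sq ler_pdivrMr //.
    by have := sqr_ge0 (n%:R : R); rewrite !expr2; lra.
  by rewrite ler_sqr ?nnegrE ?(ltW s0) //; lra.
have ktail := ler_wpM2l (ltW k0) tail.
have e4 := mulr_ge0 (ltW k0) (expR_ge0 (4 : R)).
by rewrite ler_norml; apply/andP; split; lra.
Qed.

Lemma sum_wide_gauss n :
  \sum_(0 <= k < n) wide_gauss R n k <= kappa * (Num.sqrt 2 * sd n) + 2.
Proof.
under eq_bigr do rewrite wide_gauss_normal.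
by apply: normal_sum_le; rewrite mulr_gt0 ?sd_gt0 // sqrtr_gt0.
Qed.

Definition eulerian_prob n k : R := (eulerian n k)%:R / n`!%:R.

Lemma sum_eulerian_prob n : (0 < n)%N ->
  \sum_(0 <= k < n) eulerian_prob n k = 1.
Proof.
move=> n0; rewrite -mulr_suml -natr_sum sum_eulerian // divff //.
Qed.

Definition scale n : R := amplitude R n / n`!%:R.

Lemma scale_ge0 n : 0 <= scale n.
Proof. by rewrite divr_ge0 ?amplitude_ge0. Qed.

(** A crude bound to start the bootstrap of [normalization_dist]: the central count is at most n!
    and the central deviation at most 1/2. *)
Lemma scale_le n : (0 < n)%N -> scale n <= expR 1.
Proof.
move=> n0; have f0 : 0 < n`!%:R :> R by rewrite ltr0n fact_gt0.
rewrite /scale ler_pdivrMr // /amplitude mulrC.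
have [c1 c2] := half_real R n; have n1R : 1 <= n%:R :> R by rewrite ler1n.
apply: ler_pM; rewrite ?expR_ge0 // ?ler_expR.
  rewrite ler_pdivrMr; last by lra.
  have : `|dev R n n./2| ^+ 2 <= (1 / 2) ^+ 2.
    rewrite lerXn2r ?nnegrE // ler_norml /dev.
    by apply/andP; split; lra.
  by rewrite real_normK ?num_real // !expr2; lra.
by rewrite ler_nat -card_Sn; exact: max_card.
Qed.

Lemma eulerian_prob_dist n k : (k < n)%N ->
  `|eulerian_prob n k - scale n * gauss R n k| <=
  (700 + 3 * expR 2) * scale n * (wide_gauss R n k / sd n).
Proof.
move=> kn; have f0 : 0 < n`!%:R :> R by rewrite ltr0n fact_gt0.
have -> : eulerian_prob n k - scale n * gauss R n k =
    ((eulerian n k)%:R - amplitude R n * gauss R n k) / n`!%:R.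
  by rewrite /eulerian_prob /scale; ring.
rewrite normrM normfV (gtr0_norm f0) ler_pdivrMr //.
apply: (le_trans (eulerian_gauss_dist R kn)).
have K0 : 0 <= 700 + 3 * expR 2 :> R by have := expR_ge0 (2 : R); lra.
have -> : (700 + 3 * expR 2) * scale n * (wide_gauss R n k / sd n) * n`!%:R =
    (700 + 3 * expR 2) * (amplitude R n * (wide_gauss R n k / sd n)).
  by rewrite /scale; field; rewrite !gt_eqF // sd_gt0.
rewrite -2!mulrA ler_wpM2l // ler_wpM2l ?amplitude_ge0 //.
apply: (le_trans (gauss_dist_wide R n k)).
rewrite ler_wpM2l ?expR_ge0 // lef_pV2 ?posrE ?sd_gt0 ?sqrtr_gt0 ?ltr_wpDl //.
rewrite ler_wsqrtr // ler_pdivrMr //.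
by have := ler0n R n; lra.
Qed.

(** Sums the pointwise errors against total mass 1; the wide Gaussian weights add up to O([sd n]),
    which cancels the factor 1/[sd n]. *)
Lemma norm_scale_sum n : (0 < n)%N ->
  `|1 - scale n * \sum_(0 <= k < n) gauss R n k| <=
  (700 + 3 * expR 2) * (kappa * Num.sqrt 2 + 6) * scale n.
Proof.
move=> n0; rewrite -[in leLHS](sum_eulerian_prob n0) mulr_sumr -sumrB.
apply: (le_trans (ler_norm_sum _ _ _)).
apply: (@le_trans _ _ (\sum_(0 <= k < n)
   (700 + 3 * expR 2) * scale n * (wide_gauss R n k / sd n))).
  by apply: ler_sum_nat => k /andP[_ kn]; exact: eulerian_prob_dist.
rewrite -mulr_sumr -mulr_suml -[leRHS]mulrAC.
have K0 : 0 <= 700 + 3 * expR 2 :> R by have := expR_ge0 (2 : R); lra.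
rewrite ler_wpM2l ?mulr_ge0 ?scale_ge0 // ler_pdivrMr ?sd_gt0 //.
apply: (le_trans (sum_wide_gauss n)).
(* Absorbs the additive 2 of [sum_wide_gauss] into 6 [sd n]. *)
have : 1 / 3 <= sd n.
  have h : (1 / 3) ^+ 2 <= sd n ^+ 2.
    have := ler1n R n; rewrite n0 sd_sq !expr2; lra.
  by rewrite -ler_sqr ?nnegrE ?(ltW (sd_gt0 n)) //; lra.
by lra.
Qed.

(* Once [q <= B] is known, the normalization [q S = 1 + O(q)] with
   [S = a + O(1)] bootstraps to [q = O(1/a)], then to
   [q = 1/a + O(1/a^2)]. *)
Lemma normalization_dist (q S a B C D : R) : 0 < a -> 0 <= q -> q <= B ->
  0 <= C -> 0 <= D -> `|S - a| <= C -> `|1 - q * S| <= D * q ->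
  q <= (1 + B * (C + D)) / a /\
  `|q - 1 / a| <= (C + D) * (1 + B * (C + D)) / a ^+ 2.
Proof.
move=> a0 q0 qB C0 D0 Sa qS.
have h : `|q * a - 1| <= (C + D) * q.
  have -> : q * a - 1 = - (1 - q * S) - q * (S - a) by ring.
  apply: (le_trans (ler_normB _ _)).
  rewrite normrN normrM (ger0_norm q0).
  by have := ler_wpM2l q0 Sa; lra.
have qle : q <= (1 + B * (C + D)) / a.
  rewrite ler_pdivlMr //; move: h; rewrite ler_norml => /andP[_ h].
  by have := ler_wpM2l (addr_ge0 C0 D0) qB; lra.
split=> //; have -> : q - 1 / a = (q * a - 1) / a by field; rewrite gt_eqF.
rewrite normrM normfV (gtr0_norm a0) ler_pdivrMr //.
apply: (le_trans h).
have -> : (C + D) * (1 + B * (C + D)) / a ^+ 2 * a =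
    (C + D) * ((1 + B * (C + D)) / a) by field; rewrite gt_eqF.
by rewrite ler_wpM2l // addr_ge0.
Qed.

Lemma eulerian_local_limit : exists C : R, 0 < C /\ forall n k, (k < n)%N ->
  `|eulerian_prob n k - gauss R n k / (kappa * sd n)| <= C / n%:R.
Proof.
set C1 : R := 2 + 2 * kappa * expR 4.
set K : R := 700 + 3 * expR 2.
set D : R := K * (kappa * Num.sqrt 2 + 6).
set M : R := 1 + expR 1 * (C1 + D).
have k0 := kappa_gt0.
have K0 : 0 < K by have := expR_gt0 (2 : R); rewrite /K; lra.
have C0 : 0 < C1.
  by have := mulr_gt0 k0 (expR_gt0 (4 : R)); rewrite /C1; lra.
have D0 : 0 < D.
  by rewrite mulr_gt0 // ltr_wpDl.
have CD0 : 0 < C1 + D by rewrite addr_gt0.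
have M0 : 0 < M by rewrite addr_gt0 // mulr_gt0 ?expR_gt0.
have P1 : 0 < K * M / kappa by rewrite divr_gt0 // mulr_gt0.
have P2 : 0 < (C1 + D) * M / kappa ^+ 2.
  by rewrite divr_gt0 ?mulr_gt0 // exprn_gt0.
(* Both error terms are of order 1/[sd n]^2, and 1/[sd n]^2 <= 12/n. *)
exists (12 * (K * M / kappa + (C1 + D) * M / kappa ^+ 2)).
split; first by rewrite mulr_gt0 // addr_gt0.
move=> n k kn; have n0 : (0 < n)%N by apply: leq_ltn_trans kn.
have s0 := sd_gt0 n.
have ks0 : 0 < kappa * sd n by rewrite mulr_gt0.
have [q1 q2] := normalization_dist ks0 (scale_ge0 n) (scale_le n0)
  (ltW C0) (ltW D0) (sum_gauss_dist n0) (norm_scale_sum n0).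
rewrite -/M in q1 q2.
have g1 : gauss R n k <= 1 by rewrite gauss_normal normal_fun_le1.
have w1 : wide_gauss R n k <= 1 by rewrite wide_gauss_normal normal_fun_le1.
have g0 : 0 <= gauss R n k by exact: expR_ge0.
have w0 : 0 <= wide_gauss R n k by exact: expR_ge0.
have -> : eulerian_prob n k - gauss R n k / (kappa * sd n) =
    (eulerian_prob n k - scale n * gauss R n k)
    + (scale n - 1 / (kappa * sd n)) * gauss R n k by ring.
apply: (le_trans (ler_normD _ _)).
have b1 : `|eulerian_prob n k - scale n * gauss R n k| <=
    K * M / kappa / sd n ^+ 2.
  apply: (le_trans (eulerian_prob_dist kn)).
  have -> : K * M / kappa / sd n ^+ 2 = K * (M / (kappa * sd n)) * (1 / sd n).
    by field; rewrite !gt_eqF.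
  have h1 : 0 <= K * scale n by rewrite mulr_ge0 ?scale_ge0 ?ltW.
  have h2 : 0 <= wide_gauss R n k / sd n by rewrite divr_ge0 // ltW.
  apply: (ler_pM h1 h2); first by rewrite (ler_pM2l K0).
  by rewrite ler_pM2r ?invr_gt0.
have b2 : `|(scale n - 1 / (kappa * sd n)) * gauss R n k| <=
    (C1 + D) * M / kappa ^+ 2 / sd n ^+ 2.
  rewrite normrM (ger0_norm g0).
  apply: (le_trans (ler_wpM2l (normr_ge0 _) g1)); rewrite mulr1.
  by apply: (le_trans q2); rewrite exprMn invfM mulrA.
have s12 : 1 / sd n ^+ 2 <= 12 / n%:R.
  have n0R : 0 < n%:R :> R by rewrite ltr0n.
  rewrite sd_sq invf_div mul1r ler_wpM2l // lef_pV2 ?posrE //; lra.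
have P12 := ltW (addr_gt0 P1 P2).
have := ler_wpM2l P12 s12.
lra.
Qed.

End Assembly.

Theorem theorem1p1 (R : realType) (eps : R) (eps_gt0 : 0 < eps) :
  exists C : R, 0 < C /\
    forall (n : nat) (x : int), (2 <= n)%N ->
      `| perm_prob R [set s : 'S_n | (descents s)%:Z == x]
         - 1 / (Num.sqrt (2 * pi) * des_sd R n)
           * expR (- (((x%:~R - des_mean R n) / des_sd R n) ^+ 2 / 2)) |
      <= C * n%:R `^ (-1 + eps).
Proof.
have [C [C0 llt]] := eulerian_local_limit R.
have k0 := kappa_gt0 R.
set kappa := Num.sqrt _ in llt k0 *.
have kV : 0 < 3 / kappa by rewrite divr_gt0.
exists (C + 3 / kappa); split; first by rewrite addr_gt0.
move=> n x n2; have n0 : (0 < n)%N by apply: ltnW.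
have n1R : 1 <= n%:R :> R by rewrite ler1n.
have n0R : 0 < n%:R :> R by rewrite ltr0n.
have s0 := sd_gt0 R n.
rewrite des_meanE // des_sdE // -/(sd R n).
set P := perm_prob _ _; set G := expR _.
(* The rate 1/n is at most n^(-1 + eps), so the constant does not depend on [eps]. *)
suff main : `|P - 1 / (kappa * sd R n) * G| <= (C + 3 / kappa) / n%:R.
  apply: (le_trans main); rewrite ler_wpM2l ?(ltW (addr_gt0 C0 kV)) //.
  rewrite -powR_inv1 ?(ltW n0R) // ler_powR //; lra.
have [[k [kn xk]]|out] : (exists k, (k < n)%N /\ x = k%:Z) \/
    (x < 0 \/ n%:Z <= x).
  case: x {P G} => m; last by right; left.
  case: (ltnP m n) => mn; first by left; exists m.
  by right; right.
- have -> : P = eulerian_prob R n k by rewrite /P xk perm_prob_descents.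
  have -> : G = gauss R n k.
    rewrite /G xk /gauss -/(dev R n k) expr_div_n sd_sq; congr expR.
    by field; rewrite gt_eqF // ltr_wpDl.
  rewrite mulrAC mul1r; apply: (le_trans (llt _ _ kn)).
  by rewrite ler_wpM2r ?invr_ge0 ?(ltW n0R) // lerDl ltW.
have -> : P = 0.
  rewrite /P /perm_prob (_ : [set _ | _] = finset.set0) ?cards0 ?mul0r //.
  apply/setP => s; rewrite !inE; apply/negbTE/eqP => dx.
  by move: out (descents_lt s n0); rewrite -dx; lia.
have ks0 : 0 <= 1 / (kappa * sd R n) by rewrite divr_ge0 // mulr_ge0 // ltW.
rewrite sub0r normrN normrM (ger0_norm ks0) (ger0_norm (expR_ge0 _)) -/G.
(* Outside 0, ..., n - 1 the probability is 0 and the Gaussian alone must be small: [x] is at least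
   (n + 1)/2 from the mean, so the exponent is at least 3/2 (n + 1), and exp u >= 1 + u suffices. *)
have Gn : G <= 1 / n%:R.
  have far : ((n%:R + 1) / 2) ^+ 2 <= (x%:~R - (n%:R - 1) / 2) ^+ 2 :> R.
    rewrite -[leRHS]real_normK ?num_real // lerXn2r ?nnegrE //.
    case: out => [x0|nx].
      have : x <= -1 by lia.
      rewrite -(ler_int R) rmorphN1.
      by move=> ?; rewrite ler0_norm; lra.
    have : n%:R <= x%:~R :> R by rewrite -(ler_int R) in nx.
    by move=> ?; rewrite ger0_norm; lra.
  have -> : 1 / n%:R = (n%:R)^-1 :> R by rewrite mul1r.
  rewrite /G expRN lef_pV2 ?posrE ?expR_gt0 //.
  apply: (le_trans _ (expR_ge1Dx _)).
  rewrite expr_div_n sd_sq.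
  apply: (@le_trans _ _ (1 + ((n%:R + 1) / 2) ^+ 2 / ((n%:R + 1) / 12) / 2)).
    have -> : ((n%:R + 1) / 2) ^+ 2 / ((n%:R + 1) / 12) / 2 =
        3 / 2 * (n%:R + 1) :> R.
      by field; rewrite gt_eqF // ltr_wpDl.
    by lra.
  rewrite lerD2l !ler_wpM2r // invr_ge0 divr_ge0 //; lra.
have s3 : 1 / (kappa * sd R n) <= 3 / kappa.
  have h : 1 / 3 <= sd R n.
    have h2 : (1 / 3) ^+ 2 <= sd R n ^+ 2 by rewrite sd_sq !expr2; lra.
    by rewrite -ler_sqr ?nnegrE ?(ltW s0) //; lra.
  rewrite ler_pdivrMr ?mulr_gt0 // mulrA divfK ?gt_eqF //; lra.
have -> : (C + 3 / kappa) / n%:R = C / n%:R + 3 / kappa * (1 / n%:R) by ring.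
apply: (@le_trans _ _ (3 / kappa * (1 / n%:R))).
  by apply: ler_pM; rewrite ?expR_ge0 ?divr_ge0 ?mulr_ge0 ?(ltW k0) ?(ltW s0).
by rewrite lerDr divr_ge0 ?ltW.
Qed.
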